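(* For every integer $n \geq 2$, let $$s(n) = \log n - \max\left\{\log\left(\frac{e^{2+4/e}}{2^{5+4/e}}\left(\log \frac{n}{(\log n)^2}\right)^{3+4/e}\right),\ 2\log(\log n)\right\}.$$ Then for every integer $n\geq 2$, every real number $\varepsilon\in(0,1/2)$ and every nontrivial monotone symmetric subset $A$ of $\{0,1\}^n$, $$\tau(A,\varepsilon)\leq \sup_{p\in[p(\varepsilon),p(1-\varepsilon)]}\{p(1-p)\,c_{\mathrm{LS}}(p)\}\;\frac{2\log((1-\varepsilon)/\varepsilon)}{s(n)}$$ and, in particular, $$\tau(A,\varepsilon)\leq\frac{\log((1-\varepsilon)/\varepsilon)}{s(n)}.$$
   Context: Here $\log$ is the natural logarithm. For $p\in[0,1]$, $\mu_p=\mu_{n,p}$ denotes the product Bernoulli probability measure on $\{0,1\}^n$: $\mu_{n,p}(x) = p^{\sum_{i=1}^n x_i}(1-p)^{\sum_{i=1}^n (1-x_i)}$. A subset $A\subset\{0,1\}^n$ is monotone if ($x\in A$ and $x\preceq y$) implies $y\in A$, where $\preceq$ is the coordinatewise partial order. $A$ is nontrivial if $A\neq\emptyset$ and $A\neq\{0,1\}^n$. $A$ is symmetric if there exists a subgroup $G$ of the symmetric group $\mathcal{S}_n$ acting transitively on $\{1,\ldots,n\}$ such that for all $g\in G$ and $x\in A$, $g\cdot x=(x_{g^{-1}(1)},\ldots,x_{g^{-1}(n)})\in A$. For a nontrivial monotone $A$, the map $p\mapsto\mu_p(A)$ is a continuous strictly increasing bijection of $[0,1]$; for $\alpha\in[0,1]$,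 $p(\alpha)$ denotes the unique real number in $[0,1]$ with $\mu_{p(\alpha)}(A)=\alpha$. For $\varepsilon\in(0,1/2]$, the threshold width of $A$ at level $\varepsilon$ is $\tau(A,\varepsilon)=p(1-\varepsilon)-p(\varepsilon)$. The function $c_{\mathrm{LS}}:(0,1)\to\mathbb{R}$ is defined by $c_{\mathrm{LS}}(p)=\dfrac{\log(1-p)-\log p}{(1-p)-p}$ if $p\neq \frac12$, and $c_{\mathrm{LS}}(\frac12)=2$. *)

(* Defs.v *)
From mathcomp Require Import all_boot all_order all_algebra all_fingroup.
From mathcomp Require Import all_classical all_reals all_analysis.

Set Implicit Arguments.
Unset Strict Implicit.
Unset Printing Implicit Defensive.

Import Order.TTheory GRing.Theory Num.Theory.

Local Open Scope ring_scope.
Local Open Scope classical_set_scope.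

Definition cube (n : nat) : finType := {ffun 'I_n -> bool}.

Definition mu_pt (R : realType) (n : nat) (p : R) (x : cube n) : R :=
  p ^+ (\sum_(i < n) (x i : nat))%N * (1 - p) ^+ (\sum_(i < n) (1 - x i))%N.

Definition mu (R : realType) (n : nat) (p : R) (A : {set cube n}) : R :=
  \sum_(x in A) mu_pt p x.

Definition cube_le (n : nat) (x y : cube n) : Prop :=
  forall i : 'I_n, (x i <= y i)%N.

Definition monotone_set (n : nat) (A : {set cube n}) : Prop :=
  forall x y : cube n, x \in A -> cube_le x y -> y \in A.

Definition nontrivial (n : nat) (A : {set cube n}) : Prop :=
  A <> finset.set0 /\ A <> [set: cube n]%SET.

Definition perm_cube (n : nat) (g : 'S_n) (x : cube n) : cube n :=
  [ffun i => x ((g^-1)%g i)].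

Definition symmetric_set (n : nat) (A : {set cube n}) : Prop :=
  exists G : {group 'S_n},
    [transitive G, on [set: 'I_n]%SET | 'P] /\
    forall (g : 'S_n) (x : cube n), g \in G -> x \in A -> perm_cube g x \in A.

(* The real number p(alpha). For A nontrivial monotone and 0 <= alpha <= 1,
   exactly one p satisfies the condition, so the default 0 is not used. *)
Definition p_level (R : realType) (n : nat) (A : {set cube n}) (alpha : R) : R :=
  xget 0 [set p : R | 0 <= p <= 1 /\ mu p A = alpha].

Definition threshold_width (R : realType) (n : nat) (A : {set cube n})
    (eps : R) : R :=
  p_level A (1 - eps) - p_level A eps.

(* Only meant for 0 < p < 1. *)
Definition c_LS (R : realType) (p : R) : R :=
  if p == 1 / 2 then 2 else (ln (1 - p) - ln p) / ((1 - p) - p).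

(* For n >= 2 every argument of ln below, and the base of the outer power, is
   positive, so the totalizing conventions of ln and powR play no role. *)
Definition s (R : realType) (n : nat) : R :=
  let e : R := expR 1 in
  let N : R := n%:R in
  ln N - Num.max
    (ln (e `^ (2 + 4 / e) / 2 `^ (5 + 4 / e)
         * (ln (N / ln N ^+ 2)) `^ (3 + 4 / e)))
    (2 * ln (ln N)).

(* Main.v *)
Require Import Defs.
From mathcomp Require Import all_boot all_order all_algebra all_fingroup.
From mathcomp Require Import all_classical all_reals all_analysis.
From mathcomp Require Import ring lra.

Set Implicit Arguments.
Unset Strict Implicit.
Unset Printing Implicit Defensive.

Import Order.TTheory GRing.Theory Num.Theory.
Import numFieldNormedType.Exports.

Local Open Scope ring_scope.
Local Open Scope classical_set_scope.

(** Write m for the measure of A under the Bernoulli measure of parameter p.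
    By Russo's formula the derivative D of m in p is the sum of the influences,
    so the theorem reduces to a lower bound on D.  With q = 1 - p,
    v = m (1 - m), x = p q D and c = c_LS p, the inequality wanted is
    v s(n) <= c x: integrating the derivative D / v of the log-odds of m
    between the two levels, where p q c is at most its supremum K, then bounds
    the width by K * 2 log((1 - eps) / eps) / s(n).  The second bound follows because
    p q c <= 1/2 everywhere.

    The lower bound on D comes from the argument of Falik and Samorodnitsky.
    Let f be the indicator of A and let d_1, ..., d_n be its martingale
    differences along the coordinates.  The logarithmic Sobolev inequality on
    the cube bounds the entropy of each d_k^2 by c times its energy.  Since
    averagings over distinct coordinates commute, these energies add up to the
    energy of f, which is x.  On the other hand the entropy of d^2 is at least
    w log(w / |d|_1^2), where w is the mean of d^2; summing over k with the
    log-sum inequality gives v log(v / (n B^2)) <= c x as soon as B bounds the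
    L^1 norms of all the differences.  Symmetry makes all influences equal, so
    B = 2 p q D / n is allowed and

        v log(n v / (4 x^2)) <= c x        (falik_samorodnitsky_symmetric).

    If c x < v s(n), then v <= 1/4 and c >= 2 turn this into
    log(4 n) < s(n) + 2 log s(n), against the choice of s (s_growth).

    The logarithmic Sobolev inequality, with the sharp constant c_LS p, is
    obtained on two points and then tensorized by averaging out one coordinate
    at a time.  On two points, put d = (log q - log p) / 2 and let e^(2w) be
    the ratio of the two masses q b^2 and p a^2.  The inequality
    becomes the statement that
    log cosh w - w tanh w - k / cosh w is minimal at w = d, where
    k sinh d = d: its derivative has the sign of k sinh w - w, and sinh w / w
    increases (entropy_gap_min, log_sobolev_two_points).

    The statement also requires s(n) > 0 for every n >= 2.  This is elementary
    but close to equality at n = 2, where s(2) is about 0.12, and the numerical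
    estimates below are tuned to that case (s_gt0). *)

(** * A monotonicity criterion and hyperbolic functions *)

(** The mean value theorem, with the derivative given as a function so that it
    need not be computed by [derive1]. *)
Lemma derive_ge0_le (R : realType) (f df : R -> R) (a b : R) : a <= b ->
  (forall x, a <= x <= b -> is_derive x 1 f (df x)) ->
  (forall x, a <= x <= b -> 0 <= df x) -> f a <= f b.
Proof.
move=> ab fd df0.
have fc : {within `[a, b], continuous f}.
  apply: derivable_within_continuous => x.
  by rewrite in_itv/= => /fd [].
have fd' x : x \in `]a, b[%R -> is_derive x 1 f (df x).
  by rewrite in_itv/= => /andP[ax xb]; apply: fd; rewrite !ltW.
have [c cab E] := MVT_segment ab fd' fc.
rewrite in_itv/= in cab.
by rewrite -subr_ge0 E mulr_ge0 ?subr_ge0// df0.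
Qed.

Lemma is_derive_exprn (R : realType) (g : R -> R) (dg p : R) (k : nat) :
  is_derive p 1 g dg -> is_derive p 1 (fun q => g q ^+ k) (k%:R * g p ^+ k.-1 * dg).
Proof.
move=> dgp; elim: k => [|k IH].
  by rewrite !mul0r; exact: is_derive_cst.
under eq_fun do rewrite exprS.
apply: is_derive_eq; rewrite /GRing.scale/= mulrS.
by case: k {IH} => [|k] /=; rewrite ?expr0 ?exprS; ring.
Qed.

Lemma is_derive_bigsum (R : realType) (I : Type) (s : seq I) (P : pred I) (F : I -> R -> R)
    (dF : I -> R) (p : R) : (forall i, is_derive p 1 (F i) (dF i)) ->
  is_derive p 1 (fun q => \sum_(i <- s | P i) F i q) (\sum_(i <- s | P i) dF i).
Proof.
move=> dFi; elim: s => [|i s IH].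
  by rewrite big_nil; under eq_fun do rewrite big_nil; exact: is_derive_cst.
rewrite big_cons; under eq_fun do rewrite big_cons.
by case: ifP => _ //; exact: is_deriveD.
Qed.

Definition cosh (R : realType) (x : R) : R := (expR x + expR (- x)) / 2.
Definition sinh (R : realType) (x : R) : R := (expR x - expR (- x)) / 2.

Section Hyperbolic.
Context {R : realType}.
Implicit Types x y w d : R.

Lemma cosh_gt0 x : 0 < cosh x.
Proof. by rewrite /cosh divr_gt0// addr_gt0// expR_gt0. Qed.

Lemma coshN x : cosh (- x) = cosh x.
Proof. by rewrite /cosh opprK addrC. Qed.

Lemma sinhN x : sinh (- x) = - sinh x.
Proof. by rewrite /sinh opprK -mulNr opprB. Qed.

Lemma sinh0 : sinh (0 : R) = 0.
Proof. by rewrite /sinh oppr0 subrr mul0r. Qed.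

Lemma cosh0 : cosh (0 : R) = 1.
Proof. rewrite /cosh oppr0 expR0. lra. Qed.

Lemma is_derive_cosh x : is_derive x 1 (@cosh R) (sinh x).
Proof.
rewrite /cosh /sinh.
apply: is_derive_eq; rewrite /GRing.scale/=; lra.
Qed.

Lemma is_derive_sinh x : is_derive x 1 (@sinh R) (cosh x).
Proof.
rewrite /cosh /sinh.
apply: is_derive_eq; rewrite /GRing.scale/=; lra.
Qed.

End Hyperbolic.

(** * Inequalities for hyperbolic functions *)

Section HyperbolicInequalities.
Context {R : realType}.
Implicit Types x y w d : R.

Lemma cosh_ge1 x : 1 <= cosh x.
Proof.
have [e1 e2] := (expR_gt0 x, expRxMexpNx_1 x).
rewrite /cosh ler_pdivlMr// mul1r; have := sqr_ge0 (expR x - 1); nra.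
Qed.

Lemma id_le_sinh x : 0 <= x -> x <= sinh x.
Proof.
move=> x0; rewrite -subr_ge0.
have := @derive_ge0_le R (fun y => sinh y - y) (fun y => cosh y - 1) 0 x x0.
rewrite sinh0 subrr; apply=> y _; last by rewrite subr_ge0 cosh_ge1.
by have := is_derive_sinh y => ?; apply: is_derive_eq.
Qed.

Lemma sinh_ge0 x : 0 <= x -> 0 <= sinh x.
Proof. by move=> x0; exact: le_trans (id_le_sinh x0). Qed.

Lemma sinh_le_mul_cosh x : 0 <= x -> sinh x <= x * cosh x.
Proof.
move=> x0; rewrite -subr_ge0.
have := @derive_ge0_le R (fun y => y * cosh y - sinh y) (fun y => y * sinh y) 0 x x0.
rewrite sinh0 mul0r subrr; apply=> y /andP[y0 _]; last by rewrite mulr_ge0// sinh_ge0.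
have dc := is_derive_cosh y; have ds := is_derive_sinh y.
by apply: is_derive_eq; rewrite /GRing.scale/=; ring.
Qed.

Lemma cosh_le d w : 0 <= d <= w -> cosh d <= cosh w.
Proof.
move=> /andP[d0 dw].
apply: (@derive_ge0_le R (@cosh R) (@sinh R) d w dw) => z /andP[dz zw].
  exact: is_derive_cosh.
by rewrite sinh_ge0// (le_trans d0).
Qed.

(** The chord slope sinh w / w is nondecreasing on the nonnegative reals; the
    form without division also covers d = 0. *)
Lemma sinh_slope_le d w : 0 <= d <= w -> w * sinh d <= d * sinh w.
Proof.
move=> /andP[d0 dw]; rewrite -subr_ge0.
have := @derive_ge0_le R (fun y => d * sinh y - y * sinh d)
  (fun y => d * cosh y - sinh d) d w dw.
rewrite subrr; apply=> y /andP[dy yw].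
  have ds := is_derive_sinh y.
  by apply: is_derive_eq; rewrite /GRing.scale/=; ring.
rewrite subr_ge0; apply: (le_trans (sinh_le_mul_cosh d0)).
by rewrite ler_wpM2l// cosh_le// d0.
Qed.

(** The function of w to which the two-point logarithmic Sobolev inequality
    reduces; k plays the part of d / sinh d, where d is half the log-odds. *)
Definition entropy_gap (k w : R) := ln (cosh w) - w * sinh w / cosh w - k / cosh w.

Lemma cosh2_sinh2 w : cosh w ^+ 2 - sinh w ^+ 2 = 1.
Proof. by rewrite /cosh /sinh; have := expRxMexpNx_1 w; lra. Qed.

(** The logarithm and tanh cancel except for the factor 1 / cosh^2, which leaves
    a comparison between sinh w and w. *)
Lemma is_derive_entropy_gap k w :
  is_derive w 1 (entropy_gap k) ((k * sinh w - w) / cosh w ^+ 2).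
Proof.
have c0 := cosh_gt0 w.
have c00 : cosh w != 0 by rewrite gt_eqF.
have dc := is_derive_cosh w; have ds := is_derive_sinh w.
have dV : is_derive w 1 (fun y : R => (cosh y)^-1) (- (cosh w) ^- 2 *: sinh w).
  exact: is_deriveV.
have dl : is_derive w 1 (fun y : R => ln (cosh y)) ((cosh w)^-1 * sinh w).
  by have dl := is_derive1_ln c0; exact: (@is_derive1_comp _ (@ln R) (@cosh R)).
rewrite /entropy_gap.
apply: is_derive_eq; rewrite /GRing.scale/=.
have id1 : w = w * (cosh w ^+ 2 - sinh w ^+ 2) by rewrite cosh2_sinh2 mulr1.
rewrite [X in _ = (_ - X) / _]id1.
by field.
Qed.

(** The gap is even in w, and for w >= 0 its derivative has the sign of
    k sinh w - w, which changes from nonpositive to nonnegative at w = d because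
    sinh w / w is nondecreasing.  At d = 0 the value k = 1 is the limit of
    d / sinh d. *)
Lemma entropy_gap_min k d w : k * sinh d = d ->
  (d = 0 -> k = 1) -> entropy_gap k d <= entropy_gap k w.
Proof.
wlog d0 : d / 0 <= d => [H|] kd kd0.
  have [/H|/ltW d0] := leP 0 d; first by apply.
  have -> : entropy_gap k d = entropy_gap k (- d).
    by rewrite /entropy_gap coshN sinhN mulrNN.
  apply: H; rewrite ?oppr_ge0//; first by rewrite sinhN mulrN kd.
  by move=> /eqP; rewrite oppr_eq0 => /eqP.
wlog w0 : w / 0 <= w => [H|].
  have [/H//|/ltW w0] := leP 0 w.
  have -> : entropy_gap k w = entropy_gap k (- w).
    by rewrite /entropy_gap coshN sinhN mulrNN.
  by apply: H; rewrite oppr_ge0.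
have kE z : 0 < d -> k * sinh z - z = (d * sinh z - z * sinh d) / sinh d.
  move=> dp; have sd : 0 < sinh d by apply: lt_le_trans (id_le_sinh d0).
  have -> : k = d / sinh d by rewrite -[X in X / _]kd mulfK// gt_eqF.
  by field; rewrite gt_eqF.
have sd : 0 <= sinh d := sinh_ge0 d0.
have [dw|wd] := leP d w.
  apply: (derive_ge0_le dw) => z zd; first exact: is_derive_entropy_gap.
  have z0 : 0 <= z by apply: le_trans d0 _; case/andP: zd.
  rewrite divr_ge0 ?sqr_ge0//.
  move: d0; rewrite le_eqVlt => /orP[/eqP d0|dp].
    by rewrite kd0// mul1r subr_ge0 id_le_sinh.
  rewrite kE// divr_ge0// subr_ge0 sinh_slope_le// (ltW dp)//.
  by case/andP: zd.
have dp : 0 < d := le_lt_trans w0 wd.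
rewrite -lerN2; apply: (@derive_ge0_le _ (fun z => - entropy_gap k z)
  (fun z => - ((k * sinh z - z) / cosh z ^+ 2)) w d (ltW wd)) => z /andP[wz zd].
  by have := is_derive_entropy_gap k z => ?; exact: is_deriveN.
rewrite -mulNr divr_ge0 ?sqr_ge0// kE// oppr_ge0.
have z0 : 0 <= z by exact: le_trans wz.
rewrite pmulr_lle0 ?subr_le0; last by rewrite invr_gt0 (lt_le_trans dp)// id_le_sinh.
by rewrite sinh_slope_le// z0.
Qed.
End HyperbolicInequalities.

(** * The logarithmic Sobolev inequality on two points *)

Section TwoPoint.
Context {R : realType}.
Implicit Types p a b : R.

(** In this parameter d the weights of the two points are
    e^(-d) / (2 cosh d) and e^d / (2 cosh d). *)
Definition half_log_odds (p : R) : R := (ln (1 - p) - ln p) / 2.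

Lemma bernoulli_exp p : 0 < p < 1 ->
  p * (2 * cosh (half_log_odds p)) = expR (- half_log_odds p) /\
  (1 - p) * (2 * cosh (half_log_odds p)) = expR (half_log_odds p).
Proof.
move=> /andP[p0 p1]; have q0 : 0 < 1 - p by lra.
set d := half_log_odds p.
have E : p * expR d = (1 - p) * expR (- d).
  have -> : p = expR (ln p) by rewrite lnK.
  rewrite -[1 - expR _](_ : expR (ln (1 - p)) = _); last by rewrite !lnK.
  by rewrite -!expRD; congr expR; rewrite /d /half_log_odds; lra.
by rewrite /cosh; split; lra.
Qed.

Lemma bernoulli_var p : 0 < p < 1 ->
  4 * (p * (1 - p)) * cosh (half_log_odds p) ^+ 2 = 1.
Proof.
move=> /bernoulli_exp [E1 E2].
have := expRxMexpNx_1 (half_log_odds p); rewrite -E1 -E2 => E3; lra.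
Qed.

Lemma bernoulli_diff p : 0 < p < 1 ->
  (1 - p - p) * cosh (half_log_odds p) = sinh (half_log_odds p).
Proof.
move=> /bernoulli_exp [E1 E2].
by rewrite [sinh _]/sinh -E1 -E2; lra.
Qed.

Lemma half_log_odds_eq0 p : 0 < p < 1 -> half_log_odds p = 0 -> p = 1 / 2.
Proof.
move=> /andP[p0 p1] /eqP; rewrite mulf_eq0 invr_eq0 pnatr_eq0/= orbF subr_eq0.
by move=> /eqP /ln_inj; rewrite !posrE => H; have := H ltac:(lra) p0; lra.
Qed.

(** Since tanh d = 1 - 2p, the constant c_LS p is 2 d / tanh d = 2 k cosh d
    with k = d / sinh d. *)
Lemma c_LS_slope p (k := c_LS p / (2 * cosh (half_log_odds p))) : 0 < p < 1 ->
  k * sinh (half_log_odds p) = half_log_odds p /\ (half_log_odds p = 0 -> k = 1).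
Proof.
move=> p01; have c0 := cosh_gt0 (half_log_odds p).
have hd := half_log_odds_eq0 p01.
have bd := bernoulli_diff p01.
split=> [|d0]; last first.
  by rewrite /k /c_LS d0 hd// eqxx cosh0 mulr1 divff.
rewrite -bd /k /c_LS; move: c0; set C := cosh _ => c0.
have c00 : C != 0 by rewrite gt_eqF.
case: ifPn => [/eqP ->|p12].
  rewrite /half_log_odds; have -> : 1 - 1 / 2 = 1 / 2 :> R by lra.
  by rewrite !subrr !(mul0r, mulr0).
have qp : 1 - p - p != 0 by apply: contra p12 => /eqP ?; apply/eqP; lra.
rewrite /half_log_odds; field; by rewrite qp c00.
Qed.

(** Let P and Q be the masses p a^2 and (1-p) b^2.  With
    w = d + ln b - ln a one has P + Q = a b cosh w / cosh d and
    Q - P = a b sinh w / cosh d, and the difference of the two sides of the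
    inequality equals (P + Q) times the excess of the entropy gap at w over its
    minimum, attained at d. *)
Lemma log_sobolev_two_points_gt0 p a b
    (M := p * a ^+ 2 + (1 - p) * b ^+ 2) :
  0 < p < 1 -> 0 < a -> 0 < b ->
  p * (a ^+ 2 * ln (a ^+ 2)) + (1 - p) * (b ^+ 2 * ln (b ^+ 2)) - M * ln M <=
  c_LS p * (p * (1 - p) * (a - b) ^+ 2).
Proof.
move=> p01 a0 b0.
set d := half_log_odds p.
set w := d + ln b - ln a.
have [kd kd0] := c_LS_slope p01; rewrite -/d in kd kd0.
set k := c_LS p / (2 * cosh d) in kd kd0 *.
have := entropy_gap_min w kd kd0; rewrite /entropy_gap.
have [E1 E2] := bernoulli_exp p01; rewrite -/d in E1 E2.
have var := bernoulli_var p01; rewrite -/d in var.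
have diff := bernoulli_diff p01; rewrite -/d in diff.
have CS := cosh2_sinh2 d.
have C0 := cosh_gt0 d; have W0 := cosh_gt0 w.
have cE : c_LS p = 2 * cosh d * k by rewrite /k; field; rewrite gt_eqF.
have W2 : 2 * cosh w = expR w + expR (- w) by rewrite /cosh; lra.
have S2 : 2 * sinh w = expR w - expR (- w) by rewrite /sinh; lra.
set C := cosh d in C0 E1 E2 var diff CS cE *; set W := cosh w in W0 W2 *.
set S := sinh d in kd diff CS *; set T := sinh w in S2 *.
clearbody C W S T.
have [C1 W1] : C != 0 /\ W != 0 by rewrite !gt_eqF.
have [ea eb] : a = expR (ln a) /\ b = expR (ln b) by rewrite !lnK.
set P := p * a ^+ 2 in M *; set Q := (1 - p) * b ^+ 2 in M *.
have PE : P * (2 * C) = a * b * expR (- w).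
  rewrite /P mulrAC E1 expr2 [in LHS]ea [in RHS]ea [in RHS]eb -!expRD.
  by congr expR; rewrite /w; lra.
have QE : Q * (2 * C) = a * b * expR w.
  rewrite /Q mulrAC E2 expr2 [in LHS]eb [in RHS]ea [in RHS]eb -!expRD.
  by congr expR; rewrite /w; lra.
have H1 : (Q - P) * C = a * b * T.
  by rewrite (_ : T = (expR w - expR (- w)) / 2); lra.
have H2 : M * C = a * b * W.
  by rewrite /M (_ : W = (expR w + expR (- w)) / 2); lra.
(* S, C, T, W are sinh and cosh at d and at w; H1 and H2 give Q - P and P + Q. *)
have H3 : S * (Q - P) + (a ^+ 2 + b ^+ 2) / (2 * C) = M * C.
  apply: (mulIf C1); rewrite mulrDl.
  have -> : (a ^+ 2 + b ^+ 2) / (2 * C) * C = (a ^+ 2 + b ^+ 2) / 2 * (C ^+ 2 - S ^+ 2).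
    by rewrite CS; field.
  by rewrite /M /P /Q -diff; field.
have H4 : c_LS p * (p * (1 - p)) = k / (2 * C).
  by rewrite -[RHS]mulr1 -[X in _ = _ * X]var cE; field.
have M0 : 0 < M.
  by rewrite -(pmulr_lgt0 M C0) H2 !mulr_gt0.
have lnM : ln M = ln a + ln b + ln W - ln C.
  have -> : M = a * b * W / C by rewrite -H2 mulfK.
  by rewrite ln_div ?lnM ?posrE// !mulr_gt0.
rewrite -(ler_pM2l M0) => H.
have T1 : M * (w * T / W) = w * (Q - P).
  by apply: (mulIf C1); rewrite -[RHS]mulrA H1 mulrAC H2; field.
have T2 : M * (k / W) = k * (a * b / C).
  by apply: (mulIf C1); rewrite mulrAC H2; field; rewrite C1 W1.
have T3 : d * (Q - P) + k / (2 * C) * (a ^+ 2 + b ^+ 2) = M * (d * S / C + k / C).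
  rewrite -kd -mulrA -(mulrA k) [_ + _](_ : _ = k * (M * C)).
    rewrite -[C in LHS](_ : (S ^+ 2 + 1) / C = _); first by field.
    by rewrite -CS; field.
  by rewrite -H3; field.
have -> : c_LS p * (p * (1 - p) * (a - b) ^+ 2) =
    k / (2 * C) * (a ^+ 2 + b ^+ 2) - k * (a * b / C).
  by rewrite mulrA H4; field.
rewrite !lnXn// lnM.
have wE : w = d + ln b - ln a by [].
have -> : p * (a ^+ 2 * (ln a *+ 2)) = P * (ln a * 2) by rewrite /P; ring.
have -> : (1 - p) * (b ^+ 2 * (ln b *+ 2)) = Q * (ln b * 2) by rewrite /Q; ring.
rewrite !mulrBr T1 T2 in H.
have T4 : w * (Q - P) = (d + ln b - ln a) * (Q - P) by [].
have ME : M = P + Q by [].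
rewrite T4 in H; clear -H T3 ME.
rewrite mulrDr in T3.
move: H T3; rewrite ME.
lra.
Qed.
End TwoPoint.

Section LogSobolevConstant.
Context {R : realType}.
Implicit Types p a b : R.

Lemma c_LS_sym p : c_LS (1 - p) = c_LS p.
Proof.
rewrite /c_LS (_ : (1 - p == 1 / 2) = (p == 1 / 2)); last first.
  by apply/eqP/eqP; lra.
case: ifPn => // p12; rewrite (_ : 1 - (1 - p) = p); last by ring.
have h : 1 - p - p != 0 by apply: contra p12 => /eqP ?; apply/eqP; lra.
by field; rewrite h -opprB oppr_eq0 h.
Qed.

(** In the hyperbolic parameter these are d cosh d >= sinh d and
    d <= sinh d <= sinh d cosh d. *)
Lemma c_LS_bounds p : 0 < p < 1 -> 2 <= c_LS p /\ p * (1 - p) * c_LS p <= 1 / 2.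
Proof.
wlog p12 : p / p <= 1 / 2 => [H p01|p01].
  have [/H|p12] := leP p (1 / 2); first exact.
  have := H (1 - p) ltac:(lra) ltac:(lra).
  by rewrite c_LS_sym (_ : 1 - (1 - p) = p) ?(mulrC (1 - p))//; ring.
have var := bernoulli_var p01.
have [] := c_LS_slope p01.
have : 0 <= half_log_odds p.
  rewrite divr_ge0// subr_ge0 ler_ln ?posrE; lra.
move: var; set d := half_log_odds p.
have C1 := cosh_ge1 d; set k := c_LS p / _ => var d0 kd kd0.
have cE : c_LS p = 2 * cosh d * k by rewrite /k; field; rewrite gt_eqF// cosh_gt0.
have Ed : 0 <= d -> d = 0 \/ 0 < d by rewrite le_eqVlt => /orP[/eqP<-|]; [left|right].
have [k1 kC] : k <= 1 /\ 1 <= k * cosh d.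
  case: (Ed d0) => [/[dup] /kd0 -> ->|dp]; first by rewrite cosh0 mulr1.
  have S0 : 0 < sinh d by apply: lt_le_trans (id_le_sinh d0).
  split; rewrite -(ler_pM2r S0) ?mul1r; first by rewrite kd id_le_sinh.
  by rewrite mulrAC kd sinh_le_mul_cosh.
split; first by rewrite cE; lra.
have -> : p * (1 - p) * c_LS p = k / (2 * cosh d).
  rewrite cE -[RHS]mulr1 -[X in _ = _ * X]var; field.
  by rewrite gt_eqF// cosh_gt0.
by rewrite ler_pdivrMr; lra.
Qed.

Lemma ln_ge_1BV (a : R) : 0 < a -> 1 - a^-1 <= ln a.
Proof.
move=> a0; have := @le_ln1Dx R (a^-1 - 1).
rewrite addrCA subrr addr0 lnV ?posrE// ltrBrDl subrr invr_gt0 => /(_ a0); lra.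
Qed.

Lemma ln_le_B1 (a : R) : 0 < a -> ln a <= a - 1.
Proof.
by move=> a0; have := @le_ln1Dx R (a - 1); rewrite addrCA subrr addr0; apply; lra.
Qed.

(** This is the two-point inequality at the boundary point a = 0, b = 1, obtained
    as a limit a -> 0: the terms that depend on a are at most 3 a. *)
Lemma neg_ln_le_c_LS p : 0 < p < 1 -> - ln (1 - p) <= p * c_LS p.
Proof.
move=> p01; have q0 : 0 < 1 - p by lra.
have [c2 _] := c_LS_bounds p01.
set c := c_LS p in c2 *.
rewrite leNgt; apply/negP => H.
set X := - ((1 - p) * ln (1 - p)) - c * (p * (1 - p)).
have X0 : 0 < X.
  by rewrite /X; have := mulr_gt0 q0 (_ : 0 < - ln (1 - p) - p * c); lra.
(* Small enough that the error 3 a stays below the supposed excess X. *)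
pose a := Num.min (1 / 2) (X / 4).
have a0 : 0 < a by rewrite lt_min; apply/andP; split; lra.
have a1 : a <= 1 / 2 by rewrite ge_min lexx.
have aX : a <= X / 4 by rewrite ge_min lexx orbT.
have := log_sobolev_two_points_gt0 p01 a0 ltr01; rewrite -/c.
rewrite expr1n ln1 !(mulr1, mulr0, addr0) lnXn//.
set M := p * a ^+ 2 + (1 - p).
have pa : 0 <= p * a ^+ 2 by rewrite mulr_ge0 ?sqr_ge0//; lra.
have a2 : a ^+ 2 <= a by rewrite expr2 ler_piMr// ?ltW//; lra.
have pa2 : p * a ^+ 2 <= a by apply: le_trans a2; rewrite ler_piMl ?sqr_ge0//; lra.
have M1 : M <= 1.
  rewrite /M -lerBrDr (_ : 1 - (1 - p) = p); last by ring.
  by rewrite ler_piMr//; lra.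
have M0 : 0 < M by rewrite /M; lra.
have Mq : 1 - p <= M by rewrite /M; lra.
have lM : ln M <= 0 by rewrite ln_le0.
have lq : ln M <= ln (1 - p) + p * a ^+ 2 / (1 - p).
  have -> : M = (1 - p) * (1 + p * a ^+ 2 / (1 - p)) by rewrite /M; field; lra.
  have h : 0 <= p * a ^+ 2 / (1 - p) by rewrite divr_ge0//; lra.
  rewrite lnM ?posrE//; last by lra.
  by rewrite lerD2l le_ln1Dx//; lra.
have lq' : (1 - p) * ln M <= (1 - p) * ln (1 - p) + p * a ^+ 2.
  move: lq; rewrite -(ler_pM2l q0) mulrDr => /le_trans; apply.
  by rewrite mulrCA divff ?gt_eqF// mulr1.
have MlM : M * ln M <= (1 - p) * ln M by nra.
have la : - (2 * a) <= p * (a ^+ 2 * (ln a *+ 2)).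
  have h := ln_ge_1BV a0.
  have h2 : a ^+ 2 - a <= a ^+ 2 * ln a.
    apply: (@le_trans _ _ (a ^+ 2 * (1 - a^-1))).
      by rewrite le_eqVlt; apply/orP; left; apply/eqP; field; rewrite gt_eqF.
    by rewrite ler_wpM2l// sqr_ge0.
  have h3 : 0 <= a ^+ 2 by rewrite sqr_ge0.
  nra.
have cp : 0 <= c * (p * (1 - p)) by rewrite !mulr_ge0//; lra.
have r : c * (p * (1 - p) * (a - 1) ^+ 2) <= c * (p * (1 - p)).
  by rewrite mulrA ler_piMr//; nra.
rewrite /X in aX X0; lra.
Qed.

(** Strictly positive values are covered above; when one value vanishes the
    inequality is homogeneous in the other, and becomes
    [neg_ln_le_c_LS]. *)
Theorem log_sobolev_two_points p a b
    (M := p * a ^+ 2 + (1 - p) * b ^+ 2) :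
  0 < p < 1 -> 0 <= a -> 0 <= b ->
  p * (a ^+ 2 * ln (a ^+ 2)) + (1 - p) * (b ^+ 2 * ln (b ^+ 2)) - M * ln M <=
  c_LS p * (p * (1 - p) * (a - b) ^+ 2).
Proof.
rewrite {}/M.
wlog ab : p a b / a <= b => [H p01 a0 b0|p01 a0].
  have [/H|/ltW ba] := leP a b; first exact.
  have p01' : 0 < 1 - p < 1 by lra.
  have := H (1 - p) b a ba p01' b0 a0.
  have pE : 1 - (1 - p) = p by lra.
  rewrite c_LS_sym pE (addrC ((1 - p) * _)) (addrC ((1 - p) * b ^+ 2)) => /le_trans.
  by apply; rewrite (mulrC _ p) -[b - a]opprB sqrrN.
rewrite le_eqVlt => /orP[/eqP b0|b0].
  have -> : a = 0 by apply/le_anti; rewrite a0 andbT b0.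
  by rewrite -b0 expr0n/= !(mul0r, mulr0, subr0, addr0, expr0n).
move: a0; rewrite le_eqVlt => /orP[/eqP <-|a0]; last exact: log_sobolev_two_points_gt0.
rewrite expr0n/= !(mul0r, mulr0, add0r, sub0r) sqrrN.
have q0 : 0 < 1 - p by lra.
have b2 : 0 < b ^+ 2 by rewrite exprn_gt0.
rewrite (@lnM _ (1 - p) (b ^+ 2)) ?posrE//.
have := neg_ln_le_c_LS p01; rewrite -(ler_pM2l (mulr_gt0 q0 b2)); lra.
Qed.
End LogSobolevConstant.

(** * Averaging operators on the cube *)

Section CubeOperators.
Context {R : realType} {n : nat}.
Implicit Types (p : R) (f g : cube n -> R) (x y : cube n) (i j k : 'I_n).

Definition upd x i (b : bool) : cube n := [ffun j => if j == i then b else x j].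

Definition expect p f : R := \sum_x mu_pt p x * f x.

Definition avg p i f x : R :=
  p * f (upd x i true) + (1 - p) * f (upd x i false).

Definition dev p i f x : R := f x - avg p i f x.

Definition coord_diff i f x : R := f (upd x i true) - f (upd x i false).

Lemma updC x i j a b : i != j -> upd (upd x i a) j b = upd (upd x j b) i a.
Proof.
move=> ij; apply/ffunP => k; rewrite !ffunE.
by case: (eqVneq k j) => // ->; rewrite eq_sym (negbTE ij).
Qed.

Lemma updK x i a b : upd (upd x i a) i b = upd x i b.
Proof. by apply/ffunP => k; rewrite !ffunE; case: eqP. Qed.

Lemma upd_id x i : upd x i (x i) = x.
Proof. by apply/ffunP => k; rewrite !ffunE; case: eqP => [->|]. Qed.

Lemma updE x i b : upd x i b i = b.
Proof. by rewrite ffunE eqxx. Qed.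

Lemma mu_pt_prod p x : mu_pt p x = \prod_i (if x i then p else 1 - p).
Proof.
rewrite /mu_pt !expr_sum -big_split/=; apply: eq_bigr => i _.
by case: (x i); rewrite /= ?subn0 ?subnn expr0 expr1 ?mulr1 ?mul1r.
Qed.

Lemma sum_mu_pt p : \sum_(x : cube n) mu_pt p x = 1 :> R.
Proof.
under eq_bigr do rewrite mu_pt_prod.
rewrite -(bigA_distr_bigA (fun (_ : 'I_n) (b : bool) => if b then p else 1 - p)).
by rewrite big1// => i _; rewrite big_bool/=; ring.
Qed.

Lemma expect_cst p (c : R) : expect p (fun=> c) = c.
Proof. by rewrite /expect -mulr_suml sum_mu_pt mul1r. Qed.

Lemma mu_pt_ge0 p x : 0 <= p <= 1 -> 0 <= mu_pt p x.
Proof. by move=> p01; rewrite mulr_ge0// exprn_ge0//; lra. Qed.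

Lemma mu_pt_gt0 p x : 0 < p < 1 -> 0 < mu_pt p x.
Proof. by move=> p01; rewrite mulr_gt0// exprn_gt0//; lra. Qed.

Lemma expectD p f g : expect p (fun x => f x + g x) = expect p f + expect p g.
Proof. by rewrite /expect -big_split/=; apply: eq_bigr => x _; rewrite mulrDr. Qed.

Lemma expectZ p (c : R) f : expect p (fun x => c * f x) = c * expect p f.
Proof. by rewrite /expect mulr_sumr; apply: eq_bigr => x _; rewrite mulrCA. Qed.

Lemma expectB p f g : expect p (fun x => f x - g x) = expect p f - expect p g.
Proof. by rewrite /expect -sumrB/=; apply: eq_bigr => x _; rewrite mulrBr. Qed.

Lemma expect_le p f g : 0 <= p <= 1 -> (forall x, f x <= g x) ->
  expect p f <= expect p g.
Proof. by move=> p01 fg; apply: ler_sum => x _; rewrite ler_wpM2l// mu_pt_ge0. Qed.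

Lemma expect_ge0 p f : 0 <= p <= 1 -> (forall x, 0 <= f x) -> 0 <= expect p f.
Proof. by move=> p01 f0; apply: sumr_ge0 => x _; rewrite mulr_ge0// mu_pt_ge0. Qed.

Lemma eq_expect p f g : f =1 g -> expect p f = expect p g.
Proof. by move=> /funext ->. Qed.

(** The measure is a product, so integrating first over one coordinate does not
    change the expectation. *)
Lemma expect_avg p i f : expect p (avg p i f) = expect p f.
Proof.
pose flip x := upd x i (~~ x i).
have flipK : involutive flip.
  by move=> x; rewrite /flip updE updK negbK upd_id.
pose w x := \prod_(j | j != i) (if x j then p else 1 - p).
have wE x b : w (upd x i b) = w x.
  by apply: eq_bigr => j ji; rewrite ffunE (negbTE ji).
have muE x : mu_pt p x = (if x i then p else 1 - p) * w x.
  by rewrite mu_pt_prod (bigD1 i).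
(* pairing x with its flip, both sums reduce to the points with x i = true *)
have pair (h : cube n -> R) :
    \sum_x h x = \sum_(x : cube n | x i) (h (upd x i true) + h (upd x i false)).
  rewrite (bigID (fun x => x i))/= big_split/=; congr (_ + _).
    by apply: eq_bigr => x xi; rewrite -xi upd_id.
  rewrite (reindex_inj (inv_inj flipK))/=.
  by apply: eq_big => [x|x]; rewrite /flip updE negbK// => ->.
rewrite /expect !pair; apply: eq_bigr => x xi.
by rewrite /avg !muE !updK !updE !wE; ring.
Qed.

Lemma avg_updE p i f x b : avg p i f (upd x i b) = avg p i f x.
Proof. by rewrite /avg !updK. Qed.

Lemma avgC p i j f : avg p i (avg p j f) = avg p j (avg p i f).
Proof.
have [->//|ij] := eqVneq i j; apply/funext => x; rewrite /avg.
by rewrite !(updC x _ _ ij); ring.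
Qed.

Lemma avg_dev p i j f : avg p i (dev p j f) = dev p j (avg p i f).
Proof. by apply/funext => x; rewrite [RHS]/dev avgC /avg /dev /avg; ring. Qed.

Lemma devC p i j f : dev p i (dev p j f) = dev p j (dev p i f).
Proof.
apply/funext => x; rewrite {1}/dev avg_dev [RHS]/dev avg_dev.
by rewrite /dev avgC; ring.
Qed.

Lemma expect_dev p i f : expect p (dev p i f) = 0.
Proof. by rewrite expectB expect_avg subrr. Qed.

(** Pythagoras: averaging over a coordinate is an orthogonal projection. *)
Lemma expect_sqr_split p i f : expect p (fun x => f x ^+ 2) =
  expect p (fun x => avg p i f x ^+ 2) + expect p (fun x => dev p i f x ^+ 2).
Proof.
rewrite -expectD -(expect_avg p i) -(expect_avg p i (fun x => _ + _)).
apply: eq_expect => x; rewrite {1 2}/avg /dev !avg_updE /avg; ring.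
Qed.

Lemma expect_sqr_dev p i f :
  expect p (fun x => dev p i f x ^+ 2) =
  expect p (fun x => p * (1 - p) * coord_diff i f x ^+ 2).
Proof.
rewrite -(expect_avg p i); apply: eq_expect => x.
by rewrite {1}/avg /dev !avg_updE /avg /coord_diff; ring.
Qed.

Lemma avg_ge0 p i f : 0 <= p <= 1 -> (forall x, 0 <= f x) ->
  forall x, 0 <= avg p i f x.
Proof. by move=> p01 f0 x; rewrite addr_ge0// mulr_ge0//; lra. Qed.

Lemma norm_avg p i f x : 0 <= p <= 1 ->
  `|avg p i f x| <= avg p i (fun y => `|f y|) x.
Proof.
move=> p01; apply: le_trans (ler_normD _ _) _.
by rewrite !normrM (ger0_norm (_ : 0 <= p)) ?(ger0_norm (_ : 0 <= 1 - p))//; lra.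
Qed.

End CubeOperators.

(** * Martingale decomposition and the logarithmic Sobolev inequality on the cube *)

Section Martingale.
Context {R : realType} {n : nat}.
Implicit Types (p : R) (f g u : cube n -> R) (x y : cube n) (i j k : 'I_n).

(** The conditional expectation of f given the first m coordinates: the others
    are averaged out one after the other. *)
Definition cexpect p (k : nat) f : cube n -> R := foldr (avg p) f (drop k (enum 'I_n)).

(** The martingale difference E[f | x_0, ..., x_i] - E[f | x_0, ..., x_(i-1)]. *)
Definition mdiff p i f : cube n -> R := dev p i (cexpect p i.+1 f).

Lemma cexpect_rec p i f : cexpect p i f = avg p i (cexpect p i.+1 f).
Proof.
by rewrite /cexpect (drop_nth i) ?size_enum_ord//= nth_ord_enum.
Qed.

Lemma cexpect_n p f : cexpect p n f = f.
Proof. by rewrite /cexpect drop_oversize// size_enum_ord. Qed.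

Lemma foldr_avg_dev p s j f : foldr (avg p) (dev p j f) s = dev p j (foldr (avg p) f s).
Proof. by elim: s => //= i s ->; rewrite avg_dev. Qed.

Lemma expect_foldr_avg p s f : expect p (foldr (avg p) f s) = expect p f.
Proof. by elim: s => //= i s IH; rewrite expect_avg. Qed.

Lemma foldr_avg_upd p s f i x b : i \in s ->
  foldr (avg p) f s (upd x i b) = foldr (avg p) f s x.
Proof.
elim: s x => //= j s IH x; rewrite inE => /orP[/eqP <-|/IH {}IH].
  exact: avg_updE.
have [->|ij] := eqVneq i j; first exact: avg_updE.
by rewrite /avg !(updC x _ _ ij) !IH.
Qed.

Lemma upd_invariant_cst g : (forall x i b, g (upd x i b) = g x) -> forall x y, g x = g y.
Proof.
move=> gE x y.
(* A path from x to y that changes one coordinate at a time. *)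
pose z (m : nat) : cube n := [ffun j : 'I_n => if (j < m)%N then y j else x j].
have zE m : (m <= n)%N -> g (z m) = g x.
  elim: m => [_|k IH kn].
    by congr g; apply/ffunP => j; rewrite ffunE.
  rewrite -IH ?(ltnW kn)// -(gE (z k) (Ordinal kn) (y (Ordinal kn))).
  congr g; apply/ffunP => j; rewrite !ffunE ltnS leq_eqVlt -(inj_eq val_inj)/=.
  by case: eqP => // jk; congr (y _); apply/val_inj.
rewrite -(zE n)//; congr g; apply/ffunP => j; by rewrite ffunE ltn_ord.
Qed.

(** Once all coordinates are averaged out the function is constant, and its
    value is found by integrating. *)
Lemma cexpect_0 p f : cexpect p 0 f = fun=> expect p f.
Proof.
apply/funext => x; rewrite -(expect_foldr_avg p (drop 0 (enum 'I_n))) -/(cexpect p 0 f).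
rewrite -[LHS](@expect_cst R n p); apply: eq_expect => y.
apply: upd_invariant_cst => z i b; apply: foldr_avg_upd.
by rewrite drop0 mem_enum.
Qed.

Lemma sum_telescope (a : nat -> R) : \sum_(i < n) (a i.+1 - a i) = a n - a 0%N.
Proof. 
elim: n => [|m IH]; first by rewrite big_ord0 subrr.
by rewrite big_ord_recr/= IH; ring.
 Qed.

Lemma variance_mdiff p f :
  expect p (fun x => f x ^+ 2) - expect p f ^+ 2 =
  \sum_i expect p (fun x => mdiff p i f x ^+ 2).
Proof.
pose a m := expect p (fun x => cexpect p m f x ^+ 2).
rewrite [LHS](_ : _ = a n - a 0%N); last by rewrite /a cexpect_n cexpect_0 expect_cst.
rewrite -sum_telescope; apply: eq_bigr => i _.
by rewrite /a (expect_sqr_split p i (cexpect p i.+1 f)) -cexpect_rec addrC addKr.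
Qed.

Lemma dev_mdiff p i k f : dev p i (mdiff p k f) = mdiff p k (dev p i f).
Proof. by rewrite /mdiff /cexpect foldr_avg_dev devC. Qed.

(** The differences of [dev p i f] are the functions [dev p i (mdiff p k f)]
    because averagings commute, and [dev p i f] has mean zero, so its energy is
    its variance, split along its own martingale differences. *)
Lemma sum_energy_mdiff p f :
  \sum_k \sum_i expect p (fun x => dev p i (mdiff p k f) x ^+ 2) =
  \sum_i expect p (fun x => dev p i f x ^+ 2).
Proof.
rewrite exchange_big/=; apply: eq_bigr => i _.
have := variance_mdiff p (dev p i f); rewrite expect_dev expr0n subr0 => ->.
by apply: eq_bigr => k _; rewrite dev_mdiff.
Qed.

Lemma dev_mdiff_id p k f : dev p k (mdiff p k f) = mdiff p k f.
Proof.
apply/funext => x; rewrite /mdiff /dev /avg !updK; ring.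
Qed.

Lemma expect_norm_mdiff p k f : 0 <= p <= 1 ->
  expect p (fun x => `|mdiff p k f x|) <= expect p (fun x => `|dev p k f x|).
Proof.
move=> p01; rewrite /mdiff /cexpect -foldr_avg_dev.
elim: (drop _ _) => //= i s IH; apply: le_trans IH.
rewrite -[leRHS](expect_avg p i); apply: expect_le => // x; exact: norm_avg.
Qed.

Lemma cexpect_ge0 p (k : nat) u : 0 <= p <= 1 -> (forall x, 0 <= u x) ->
  forall x, 0 <= cexpect p k u x.
Proof.
by move=> p01 u0; rewrite /cexpect; elim: (drop _ _) => //= i s IH; exact: avg_ge0.
Qed.

(** The energy of the square root of u in direction k.  Working with u rather
    than its root lets u be averaged coordinate by coordinate. *)
Definition sqrt_energy p k u : R :=
  expect p (fun x => p * (1 - p) * coord_diff k (fun y => Num.sqrt (u y)) x ^+ 2).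

(** The two-point inequality on each fibre in direction k. *)
Lemma entropy_avg_le p k u : 0 < p < 1 -> (forall x, 0 <= u x) ->
  expect p (fun x => u x * ln (u x)) -
  expect p (fun x => avg p k u x * ln (avg p k u x)) <= c_LS p * sqrt_energy p k u.
Proof.
move=> p01 u0; rewrite -(expect_avg p k (fun x => u x * ln (u x))) -expectB -expectZ.
apply: expect_le => [|x]; first lra.
have := log_sobolev_two_points p01 (sqrtr_ge0 (u (upd x k true)))
  (sqrtr_ge0 (u (upd x k false))).
by rewrite !sqr_sqrtr.
Qed.

(** The reverse triangle inequality in L^2 of the two-point space, applied to
    the vectors of square roots (sqrt a, sqrt b) and (sqrt c, sqrt d). *)
Lemma sqrt_pair_contract p (a b c d : R) : 0 <= p <= 1 ->
  0 <= a -> 0 <= b -> 0 <= c -> 0 <= d ->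
  (Num.sqrt (p * a + (1 - p) * b) - Num.sqrt (p * c + (1 - p) * d)) ^+ 2 <=
  p * (Num.sqrt a - Num.sqrt c) ^+ 2 + (1 - p) * (Num.sqrt b - Num.sqrt d) ^+ 2.
Proof.
move=> p01 a0 b0 c0 d0.
have q0 : 0 <= 1 - p by lra.
have p0 : 0 <= p by lra.
rewrite -{1}(sqr_sqrtr a0) -{1}(sqr_sqrtr b0) -{1}(sqr_sqrtr c0) -{1}(sqr_sqrtr d0).
move: (Num.sqrt a) (Num.sqrt b) (Num.sqrt c) (Num.sqrt d) (sqrtr_ge0 a) (sqrtr_ge0 b)
  (sqrtr_ge0 c) (sqrtr_ge0 d) => {a0 b0 c0 d0} {}a {}b {}c {}d a0 b0 c0 d0.
have X0 : 0 <= p * a ^+ 2 + (1 - p) * b ^+ 2 by rewrite addr_ge0// mulr_ge0// sqr_ge0.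
have Y0 : 0 <= p * c ^+ 2 + (1 - p) * d ^+ 2 by rewrite addr_ge0// mulr_ge0// sqr_ge0.
have CS : p * a * c + (1 - p) * b * d <=
    Num.sqrt (p * a ^+ 2 + (1 - p) * b ^+ 2) * Num.sqrt (p * c ^+ 2 + (1 - p) * d ^+ 2).
  rewrite -sqrtrM// -[leLHS]ger0_norm ?addr_ge0 ?mulr_ge0// -sqrtr_sqr ler_wsqrtr//.
  rewrite -subr_ge0 [_ - _](_ : _ = p * (1 - p) * (a * d - b * c) ^+ 2); last by ring.
  by rewrite mulr_ge0 ?sqr_ge0// mulr_ge0.
rewrite sqrrB !sqr_sqrtr//; lra.
Qed.

Lemma sqrt_energy_avg p i k u : 0 <= p <= 1 -> (forall x, 0 <= u x) -> i != k ->
  sqrt_energy p k (avg p i u) <= sqrt_energy p k u.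
Proof.
move=> p01 u0 ik; rewrite /sqrt_energy.
rewrite -[leRHS](expect_avg p i); apply: expect_le => // x.
rewrite {2}/avg /coord_diff /avg -!(updC x _ _ ik).
pose r b b' := Num.sqrt (u (upd (upd x i b) k b')).
rewrite [leRHS](_ : _ = p * (1 - p) * (p * (r true true - r true false) ^+ 2 +
  (1 - p) * (r false true - r false false) ^+ 2)); last by rewrite /r; ring.
by rewrite ler_wpM2l ?sqrt_pair_contract// mulr_ge0//; lra.
Qed.

Lemma sqrt_energy_cexpect p k u : 0 <= p <= 1 -> (forall x, 0 <= u x) ->
  sqrt_energy p k (cexpect p k.+1 u) <= sqrt_energy p k u.
Proof.
move=> p01 u0; rewrite /cexpect.
have : k \notin drop k.+1 (enum 'I_n).
  have := enum_uniq 'I_n; rewrite -[X in uniq X](cat_take_drop k.+1) cat_uniq.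
  move=> /and3P[_ /hasPn H _]; apply/negP => kd; move: (H k kd).
  by rewrite /= (take_nth k) ?size_enum_ord// nth_ord_enum mem_rcons inE eqxx//.
elim: (drop _ _) => //= i s IH; rewrite inE negb_or eq_sym => /andP[ik ks].
apply: le_trans (IH ks); apply: sqrt_energy_avg => // x.
by elim: s {IH ks} x => //= j s IH; exact: avg_ge0.
Qed.

(** Averaging g^2 over one coordinate after the other, the entropy drops at each
    step by at most c_LS p times the energy in that direction of the root of the
    function reached; this energy is at most the original one, since averaging
    over the other coordinates contracts it and |g| varies less than g. *)
Theorem log_sobolev_cube p g : 0 < p < 1 ->
  expect p (fun x => g x ^+ 2 * ln (g x ^+ 2)) -
  expect p (fun x => g x ^+ 2) * ln (expect p (fun x => g x ^+ 2)) <=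
  c_LS p * \sum_i expect p (fun x => dev p i g x ^+ 2).
Proof.
move=> p01; have p01' : 0 <= p <= 1 by lra.
pose u x := g x ^+ 2; have u0 x : 0 <= u x by exact: sqr_ge0.
pose a m := expect p (fun x => cexpect p m u x * ln (cexpect p m u x)).
rewrite [leLHS](_ : _ = a n - a 0%N); last by rewrite /a cexpect_n cexpect_0 expect_cst.
rewrite -sum_telescope mulr_sumr; apply: ler_sum => i _.
rewrite /a cexpect_rec; apply: le_trans (entropy_avg_le i p01 (cexpect_ge0 i.+1 p01' u0)) _.
have [c2 _] := c_LS_bounds p01.
rewrite ler_wpM2l//; first lra.
apply: le_trans (sqrt_energy_cexpect i p01' u0) _.
rewrite expect_sqr_dev; apply: expect_le => // x; rewrite /coord_diff /u !sqrtr_sqr.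
rewrite ler_wpM2l ?mulr_ge0//; try lra.
rewrite -[leRHS]real_normK ?num_real// -[leLHS]real_normK ?num_real//.
by rewrite lerXn2r ?nnegrE// ler_dist_dist.
Qed.

End Martingale.

(** * The Falik-Samorodnitsky inequality *)

Section FalikSamorodnitsky.
Context {R : realType} {n : nat}.
Implicit Types (p : R) (f g u : cube n -> R).

Lemma expect_sqr_eq0 p g : 0 < p < 1 ->
  expect p (fun x => g x ^+ 2) = 0 -> g = fun=> 0.
Proof.
move=> p01 /psumr_eq0P H; apply/funext => x.
have /H/(_ x isT)/eqP : forall y, true -> 0 <= mu_pt p y * g y ^+ 2.
  by move=> y _; rewrite mulr_ge0 ?sqr_ge0// ltW// mu_pt_gt0.
by rewrite mulf_eq0 gt_eqF ?mu_pt_gt0//= sqrf_eq0 => /eqP.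
Qed.

(** Jensen's inequality for the logarithm under the density proportional to g^2,
    proved through the tangent ln z >= 1 - 1/z at z = |g| / r, with
    r = w / B. *)
Lemma entropy_ge_norm1 p g (B : R) (w := expect p (fun x => g x ^+ 2)) :
  0 < p < 1 -> 0 < B -> expect p (fun x => `|g x|) <= B ->
  w * ln (w / B ^+ 2) <= expect p (fun x => g x ^+ 2 * ln (g x ^+ 2)) - w * ln w.
Proof.
move=> p01 B0 gB; have p01' : 0 <= p <= 1 by lra.
have : 0 <= w by apply: expect_ge0 => // x; exact: sqr_ge0.
rewrite le_eqVlt => /orP[/eqP/esym w0|w0].
  rewrite w0 !mul0r subr0; have -> := expect_sqr_eq0 p01 w0.
  by rewrite expr0n/= mul0r expect_cst.
pose r := w / B; have r0 : 0 < r by rewrite divr_gt0.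
have key x : g x ^+ 2 * ln (r ^+ 2) + 2 * (g x ^+ 2 - r * `|g x|) <= g x ^+ 2 * ln (g x ^+ 2).
  rewrite -(real_normK (num_real (g x))); have := normr_ge0 (g x).
  rewrite le_eqVlt => /orP[/eqP <-|].
    by rewrite expr0n/= !(mul0r, mulr0) subrr mulr0 addr0.
  move: (`|g x|) => z z0.
  have /ln_ge_1BV : 0 < z / r by rewrite divr_gt0.
  rewrite ln_div ?posrE// invf_div -(ler_pM2l (_ : 0 < z ^+ 2)) ?exprn_gt0//.
  rewrite (_ : z ^+ 2 * (1 - r / z) = z ^+ 2 - r * z); last by field; rewrite gt_eqF.
  by rewrite !lnXn//; lra.
have := expect_le p01' key.
rewrite expectD expectZ expectB expectZ -/w.
rewrite (eq_expect p (_ : _ =1 fun x => ln (r ^+ 2) * g x ^+ 2)); last first.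
  by move=> x; rewrite mulrC.
rewrite expectZ -/w => H.
have : r * expect p (fun x => `|g x|) <= w.
  have rB : r * B = w by rewrite /r divfK// gt_eqF.
  by rewrite -rB ler_wpM2l// ltW.
have -> : ln (w / B ^+ 2) = ln (r ^+ 2) - ln w; last by lra.
rewrite -ln_div ?posrE ?exprn_gt0//; congr ln; rewrite /r; field.
by rewrite !gt_eqF.
Qed.

(** Convexity of t ln t, through its tangent at the mean W / n. *)
Lemma log_sum_ge (w : 'I_n -> R) (W := \sum_i w i) : (forall i, 0 <= w i) -> 0 < W ->
  W * ln (W / n%:R) <= \sum_i w i * ln (w i).
Proof.
move=> w0 W0.
have n0 : 0 < n%:R :> R.
  rewrite ltr0n lt0n; apply/eqP => n0; move: W0; rewrite /W.
  by rewrite big1 ?ltxx// => i; move: (ltn_ord i); rewrite [X in (_ < X)%N]n0.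
pose t := W / n%:R; have t0 : 0 < t by rewrite divr_gt0.
have key i : w i * ln t + w i - t <= w i * ln (w i).
  have := w0 i; rewrite le_eqVlt => /orP[/eqP <-|wi0].
    by rewrite !mul0r addr0 sub0r oppr_le0 ltW.
  have /ln_ge_1BV : 0 < w i / t by rewrite divr_gt0.
  rewrite ln_div ?posrE// invf_div -(ler_pM2l wi0).
  rewrite (_ : w i * (1 - t / w i) = w i - t); last by field; rewrite gt_eqF.
  lra.
apply: le_trans (ler_sum _ (fun i _ => key i)).
rewrite sumrB big_split/= -mulr_suml -/W sumr_const card_ord -[t *+ _]mulr_natr /t.
by rewrite divfK ?gt_eqF// addrK.
Qed.

(** Each martingale difference has L^1 norm at most B, as a conditional
    expectation of [dev p i f]; its entropy is bounded below by [entropy_ge_norm1]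
    and above by the logarithmic Sobolev inequality.  The log-sum inequality and
    [sum_energy_mdiff] add up the two families of bounds. *)
Theorem falik_samorodnitsky p f (B : R)
    (v := expect p (fun x => f x ^+ 2) - expect p f ^+ 2) :
  0 < p < 1 -> 0 < B -> (forall i, expect p (fun x => `|dev p i f x|) <= B) ->
  0 < v ->
  v * ln (v / (n%:R * B ^+ 2)) <= c_LS p * \sum_i expect p (fun x => dev p i f x ^+ 2).
Proof.
move=> p01 B0 fB v0; have p01' : 0 <= p <= 1 by lra.
pose w i := expect p (fun x => mdiff p i f x ^+ 2).
have vE : v = \sum_i w i by exact: variance_mdiff.
have w0 i : 0 <= w i by apply: expect_ge0 => // x; exact: sqr_ge0.
have n0 : 0 < n%:R :> R.
  rewrite ltr0n lt0n; apply/eqP => n0; move: v0; rewrite vE.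
  by rewrite big1 ?ltxx// => i; move: (ltn_ord i); rewrite [X in (_ < X)%N]n0.
rewrite -sum_energy_mdiff mulr_sumr.
have B20 : 0 < B ^+ 2 by rewrite exprn_gt0.
apply: (@le_trans _ _ (\sum_i (w i * ln (w i) - w i * ln (B ^+ 2)))).
  rewrite sumrB -mulr_suml -vE invfM mulrA ln_div ?posrE//; last by rewrite divr_gt0.
  by rewrite mulrBr lerD2r vE log_sum_ge// -vE.
apply: ler_sum => i _.
apply: le_trans (log_sobolev_cube (mdiff p i f) p01).
apply: le_trans (entropy_ge_norm1 p01 B0 _); last first.
  exact: le_trans (expect_norm_mdiff _ _ p01') (fB i).
rewrite -/(w i); have := w0 i; rewrite le_eqVlt => /orP[/eqP <-|wi0].
  by rewrite !mul0r subrr.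
by rewrite ln_div ?posrE// mulrBr.
Qed.

(** The variance is the sum of the energies of the differences in their own
    direction only, hence at most their total energy. *)
Lemma poincare p f : 0 < p < 1 ->
  expect p (fun x => f x ^+ 2) - expect p f ^+ 2 <=
  \sum_i expect p (fun x => dev p i f x ^+ 2).
Proof.
move=> p01; rewrite variance_mdiff -sum_energy_mdiff; apply: ler_sum => k _.
rewrite (bigD1 k)//= dev_mdiff_id lerDl sumr_ge0// => i _.
by apply: expect_ge0 => [|x]; [lra|exact: sqr_ge0].
Qed.
End FalikSamorodnitsky.

(** * Influences of monotone sets *)

Section MonotoneSets.
Context {R : realType} {n : nat}.
Implicit Types (p : R) (A : {set cube n}) (x y : cube n) (i j : 'I_n).

Definition ind A x : R := (x \in A)%:R.

(** For a monotone set, the probability that coordinate i is pivotal. *)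
Definition influence p A i : R := expect p (coord_diff i (ind A)).

Lemma mu_expect p A : mu p A = expect p (ind A).
Proof.
rewrite /mu /expect big_mkcond/=; apply: eq_bigr => x _.
by rewrite /ind; case: (x \in A); rewrite ?mulr1 ?mulr0.
Qed.

Lemma mu_gt0_lt1 p A : 0 < p < 1 -> nontrivial A -> 0 < mu p A < 1.
Proof.
move=> p01 [A0 A1].
have gt0 (B : {set cube n}) : B <> finset.set0 -> 0 < mu p B.
  move=> /eqP /set0Pn[x xB]; rewrite /mu (bigD1 x)//= ltr_pwDl ?mu_pt_gt0//.
  by apply: sumr_ge0 => y _; rewrite ltW// mu_pt_gt0.
rewrite gt0//= -(sum_mu_pt (n := n) p) (bigID (mem A))/= ltrDl.
rewrite (eq_bigl (mem (~: A)%SET)); last by move=> x; rewrite /= !inE.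
apply: gt0 => H; apply: A1; rewrite -(finset.setCK A) H finset.setC0//.
Qed.

Lemma coord_diff_ind A i x : monotone_set A -> coord_diff i (ind A) x = 0 \/ coord_diff i (ind A) x = 1.
Proof.
move=> mA; rewrite /coord_diff /ind.
have le : cube_le (upd x i false) (upd x i true).
  by move=> j; rewrite !ffunE; case: eqP.
have [f1|f1] := boolP (upd x i false \in A).
  by rewrite (mA _ _ f1 le) subrr; left.
by case: (_ \in A); rewrite subr0; [right|left].
Qed.

Lemma expect_sqr_dev_ind p A i : monotone_set A ->
  expect p (fun x => dev p i (ind A) x ^+ 2) = p * (1 - p) * influence p A i.
Proof.
move=> mA; rewrite expect_sqr_dev -expectZ; apply: eq_expect => x.
by case: (coord_diff_ind i x mA) => ->; rewrite ?expr0n ?expr1n.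
Qed.

Lemma expect_norm_dev_ind p A i : 0 < p < 1 -> monotone_set A ->
  expect p (fun x => `|dev p i (ind A) x|) = 2 * (p * (1 - p)) * influence p A i.
Proof.
move=> p01 mA; rewrite -(expect_avg p i) -expectZ; apply: eq_expect => x.
rewrite {1}/avg /dev !avg_updE.
have -> : ind A (upd x i true) - avg p i (ind A) x = (1 - p) * coord_diff i (ind A) x.
  by rewrite /avg /coord_diff; ring.
have -> : ind A (upd x i false) - avg p i (ind A) x = - (p * coord_diff i (ind A) x).
  by rewrite /avg /coord_diff; ring.
rewrite normrN !normrM !ger0_norm; try lra.
by case: (coord_diff_ind i x mA) => ->; lra.
Qed.

(** The logarithmic derivative in p of the weight of coordinate i. *)
Definition score p i x : R := if x i then p^-1 else - (1 - p)^-1.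

Lemma is_derive_mu_pt_poly p x
    (k := (\sum_i (x i : nat))%N) (m := (\sum_i (1 - x i))%N) :
  is_derive p 1 (fun q => mu_pt q x)
    (p ^+ k * (m%:R * (1 - p) ^+ m.-1 * -1) + (1 - p) ^+ m * (k%:R * p ^+ k.-1)).
Proof.
have dq : is_derive p 1 (fun q : R => 1 - q) (- 1).
  by apply: is_derive_eq; rewrite add0r mul1r.
have dk := is_derive_exprn k (is_derive_id p 1).
have dm := is_derive_exprn m dq.
rewrite /mu_pt -/k -/m.
by apply: is_derive_eq; rewrite /GRing.scale/= mulr1.
Qed.

Lemma derivable_mu p A : derivable (fun q => mu q A) p 1.
Proof.
have [] := is_derive_bigsum (index_enum _) (fun x => x \in A)
  (is_derive_mu_pt_poly p).
by [].
Qed.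

Lemma is_derive_mu_pt p x : 0 < p < 1 ->
  is_derive p 1 (fun q => mu_pt q x) (mu_pt p x * \sum_i score p i x).
Proof.
move=> p01; have := is_derive_mu_pt_poly p x.
set k := (\sum_i (x i : nat))%N; set m := (\sum_i (1 - x i))%N => dmu.
have -> : \sum_i score p i x = k%:R / p - m%:R / (1 - p).
  rewrite /k /m !natr_sum !mulr_suml -sumrB; apply: eq_bigr => i _.
  by rewrite /score; case: (x i); rewrite ?subnn ?subn0 /= ?mul0r ?mul1r ?subr0 ?sub0r.
apply: is_derive_eq.
have powE (z : R) (l : nat) : z != 0 -> l%:R * z ^+ l.-1 = l%:R / z * z ^+ l.
  case: l => [|l] z0; first by rewrite !mul0r.
  by rewrite exprS /=; field.
rewrite !powE; try by rewrite gt_eqF; lra.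
by rewrite /mu_pt -/k -/m; ring.
Qed.

(** Differentiating the product weight multiplies it by the sum of the scores,
    and averaging an indicator times the score of coordinate i over that
    coordinate yields its discrete difference. *)
Lemma russo p A : 0 < p < 1 ->
  is_derive p 1 (fun q => mu q A) (\sum_i influence p A i).
Proof.
move=> p01.
have H := is_derive_bigsum (index_enum _) (fun x => x \in A) (fun x => is_derive_mu_pt x p01).
rewrite /mu [X in is_derive _ _ _ X](_ : _ =
  \sum_(x in A) mu_pt p x * \sum_i score p i x)//.
transitivity (\sum_i expect p (fun x => ind A x * score p i x)); last first.
  rewrite exchange_big/= [RHS]big_mkcond/=; apply: eq_bigr => x _.
  rewrite -mulr_sumr -mulr_sumr /ind.
  by case: (x \in A); rewrite ?mul1r ?mul0r ?mulr0.
apply: eq_bigr => i _; rewrite -(expect_avg p i (fun x => _ * _)).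
apply: eq_expect => x; rewrite /avg /coord_diff /score !updE.
by field; apply/andP; split; rewrite gt_eqF; lra.
Qed.

Lemma perm_cubeK (g : 'S_n) : cancel (perm_cube g) (perm_cube g^-1).
Proof. by move=> x; apply/ffunP => i; rewrite !ffunE invgK permK. Qed.

Lemma perm_cube_upd (g : 'S_n) x i b : perm_cube g (upd x i b) = upd (perm_cube g x) (g i) b.
Proof.
apply/ffunP => j; rewrite !ffunE; congr (if _ then _ else _).
by rewrite -(inj_eq (@perm_inj _ g)) permKV.
Qed.

Lemma mu_pt_perm p (g : 'S_n) x : mu_pt p (perm_cube g x) = mu_pt p x.
Proof.
rewrite !mu_pt_prod (reindex_inj (@perm_inj _ g))/=.
by apply: eq_bigr => i _; rewrite ffunE permK.
Qed.

(** The group preserves both the measure and A, and moves i to j. *)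
Lemma influence_sym p A i j : symmetric_set A -> influence p A i = influence p A j.
Proof.
move=> [G [tG GA]].
have [g gG ->] : exists2 g, g \in G & j = aperm i g.
  by apply: (atransP2 tG); rewrite inE.
have indE x : ind A (perm_cube g x) = ind A x.
  rewrite /ind; congr ((nat_of_bool _)%:R); apply/idP/idP => [gx|]; last exact: GA.
  by rewrite -(perm_cubeK g x) GA// groupV.
rewrite /influence /expect [RHS](reindex_inj (can_inj (perm_cubeK g)))/=.
apply: eq_bigr => x _; rewrite mu_pt_perm /coord_diff /aperm.
by rewrite -!perm_cube_upd !indE.
Qed.

(** The inequality of Falik and Samorodnitsky for the indicator of A, whose
    energies are p (1-p) times the influences and whose deviations have L^1 norm
    2 p (1-p) times the common influence. *)
Theorem falik_samorodnitsky_symmetric p A (m := mu p A) (D := \sum_i influence p A i)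
    (v := m * (1 - m)) (x := p * (1 - p) * D) :
  0 < p < 1 -> nontrivial A -> monotone_set A -> symmetric_set A ->
  [/\ 0 < v, v <= x & v * ln (n%:R * v / (4 * x ^+ 2)) <= c_LS p * x].
Proof.
move=> p01 ntA mA sA; have m01 := mu_gt0_lt1 p01 ntA.
have v0 : 0 < v by rewrite mulr_gt0//; rewrite -/m in m01; lra.
have vE : v = expect p (fun y => ind A y ^+ 2) - expect p (ind A) ^+ 2.
  rewrite (_ : (fun y => _) = ind A); first by rewrite -mu_expect /v /m; ring.
  by apply/funext => y; rewrite /ind; case: (_ \in A); rewrite ?expr0n ?expr1n.
have xE : x = \sum_i expect p (fun y => dev p i (ind A) y ^+ 2).
  by rewrite /x mulr_sumr; apply: eq_bigr => i _; rewrite expect_sqr_dev_ind.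
have vx : v <= x by rewrite vE xE poincare.
split=> //.
have x0 : 0 < x := lt_le_trans v0 vx.
have n0 : (0 < n)%N.
  rewrite lt0n; apply/eqP => n0; move: x0; rewrite xE.
  by rewrite big1 ?ltxx// => i; move: (ltn_ord i); rewrite [X in (_ < X)%N]n0.
have nR : 0 < n%:R :> R by rewrite ltr0n.
pose i0 := Ordinal n0.
have DE : D = n%:R * influence p A i0.
  rewrite /D (eq_bigr (fun=> influence p A i0)) => [|i _]; last exact: influence_sym.
  by rewrite sumr_const card_ord [RHS]mulr_natl.
have xI : x = p * (1 - p) * influence p A i0 * n%:R by rewrite /x DE; ring.
pose B := 2 * (p * (1 - p)) * influence p A i0.
have B0 : 0 < B.
  move: x0; rewrite xI (pmulr_lgt0 _ nR) /B => x0; lra.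
have fB i : expect p (fun y => `|dev p i (ind A) y|) <= B.
  by rewrite expect_norm_dev_ind// (influence_sym p i i0 sA).
have := falik_samorodnitsky p01 B0 fB; rewrite -vE -xE => /(_ v0).
rewrite (_ : v / (n%:R * B ^+ 2) = n%:R * v / (4 * x ^+ 2))//.
have I0 : influence p A i0 != 0.
  by apply/eqP => I0; move: B0; rewrite /B I0 mulr0 ltxx.
rewrite xI /B; field.
by rewrite I0 !gt_eqF//; lra.
Qed.
End MonotoneSets.

(** * Numerical bounds on logarithms *)

Section Numerics.
Context {R : realType}.
Implicit Types x : R.

(** This is u <= sinh u at u = ln x. *)
Lemma ln_le_half_diff x : 1 <= x -> ln x <= (x - x^-1) / 2.
Proof.
move=> x1; have x0 : 0 < x by lra.
by have := id_le_sinh (ln_ge0 x1); rewrite /sinh expRN lnK.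
Qed.

(** This is tanh u <= u at u = ln x / 2. *)
Lemma ln_ge_two_ratio x : 1 <= x -> 2 * (x - 1) <= ln x * (x + 1).
Proof.
move=> x1; have x0 : 0 < x by lra.
set u := ln x / 2.
have u0 : 0 <= u by rewrite divr_ge0// ln_ge0.
have r0 := expR_gt0 u.
have rr : expR u * expR u = x by rewrite -expRD /u -splitr lnK.
have := sinh_le_mul_cosh u0; rewrite /sinh /cosh => H.
rewrite (_ : ln x = 2 * u); last by rewrite /u; lra.
have re := expRxMexpNx_1 u.
have ue : u * (expR u * expR (- u)) = u by rewrite re mulr1.
by move: H; rewrite -(ler_pM2l r0) -rr; lra.
Qed.

(** Two is the product of 5/4, 6/5, 7/6 and 8/7, and on each factor the two
    elementary bounds on the logarithm are close to one another. *)
Lemma ln2_bounds : 691 / 1000 <= ln (2 : R) <= 698 / 1000.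
Proof.
have E : ln (2 : R) = ln (5 / 4) + ln (6 / 5) + ln (7 / 6) + ln (8 / 7).
  rewrite -!lnM ?posrE; try lra.
  by congr ln; lra.
have [h5 h6 h7 h8] : [/\ 1 <= 5 / 4 :> R, 1 <= 6 / 5 :> R, 1 <= 7 / 6 :> R & 1 <= 8 / 7 :> R].
  by split; lra.
have := (ln_le_half_diff h5, ln_le_half_diff h6, ln_le_half_diff h7, ln_le_half_diff h8).
rewrite ?invf_div => -[[[? ?] ?] ?].
have := (ln_ge_two_ratio h5, ln_ge_two_ratio h6, ln_ge_two_ratio h7, ln_ge_two_ratio h8).
rewrite ?invf_div => -[[[? ?] ?] ?].
rewrite E; apply/andP; split; lra.
Qed.

(** From 1 + t <= e^t at t = 1/32 for the lower bound and t = -1/6 for the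
    upper one. *)
Lemma expR1_bounds : 8 / 3 <= expR (1 : R) <= 3.
Proof.
apply/andP; split.
  rewrite (_ : 1 = 32%:R * 32%:R^-1 :> R); last by rewrite divff.
  rewrite expRM_natl; have := expR_ge1Dx (32%:R^-1 : R).
  move=> H; apply: (@le_trans _ _ ((33 / 32) ^+ 32)); first lra.
  rewrite lerXn2r ?nnegrE//; lra.
rewrite -[leRHS]invrK -[leLHS]invrK -expRN lef_pV2 ?posrE ?expR_gt0//; try lra.
rewrite (_ : -1 = 6%:R * - 6%:R^-1 :> R); last by rewrite mulrN divff.
rewrite expRM_natl; have := expR_ge1Dx (- 6%:R^-1 : R).
move=> H; apply: (@le_trans _ _ ((5 / 6) ^+ 6)); first lra.
rewrite lerXn2r ?nnegrE//; lra.
Qed.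
End Numerics.

(** * The rate s(n) *)

Section ThresholdRate.
Context {R : realType}.
Implicit Types (t L : R) (n : nat).

(** The exponent 3 + 4/e; the two other exponents in the definition of s are
    smaller by 1 and larger by 2. *)
Definition log_exponent : R := 3 + 4 / expR 1.

Lemma log_exponent_bounds : 4 <= log_exponent <= 9 / 2.
Proof.
have [/andP[e1 e2] e0] := (@expR1_bounds R, @expR_gt0 R 1).
rewrite /log_exponent; apply/andP; split.
  by rewrite -lerBlDl ler_pdivlMr//; lra.
by rewrite -lerBrDl ler_pdivrMr//; lra.
Qed.

Lemma iter_log_gt0 t : 0 < t -> 0 < t - 2 * ln t.
Proof.
move=> t0; have := @ln_le_B1 R (t / 2); rewrite divr_gt0// ln_div ?posrE//.
by move=> /(_ isT); have /andP[_ h] := @ln2_bounds R; lra.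
Qed.

Lemma ln_nat_ge n : (2 <= n)%N -> ln 2 <= ln n%:R :> R.
Proof. by move=> n2; rewrite ler_ln ?posrE ?ltr0n ?ler_nat//; apply: leq_trans n2. Qed.

Lemma sE n (t := ln n%:R : R) (a := log_exponent) : (2 <= n)%N ->
  s R n = t - Num.max (a - 1 - (a + 2) * ln 2 + a * ln (t - 2 * ln t)) (2 * ln t).
Proof.
move=> n2; have n0 : 0 < n%:R :> R by rewrite ltr0n; apply: leq_trans n2.
have /andP[l2 _] := @ln2_bounds R.
have t0 : 0 < t by have := ln_nat_ge n2; rewrite -/t; lra.
have LE : ln (n%:R / t ^+ 2) = t - 2 * ln t.
  by rewrite ln_div ?posrE ?exprn_gt0// lnXn// -/t mulr_natl.
have L0 := iter_log_gt0 t0.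
have e0 := @expR_gt0 R 1.
rewrite /s -/t LE; congr (t - Num.max _ _).
rewrite lnM ?posrE ?divr_gt0 ?powR_gt0// ln_div ?posrE ?powR_gt0// !ln_powR expRK.
rewrite /a /log_exponent; ring.
Qed.

(** With t = ln n, L = t - 2 ln t and a = 3 + 4/e, the point is
    a - 1 - (a + 2) ln 2 + a ln L < t.  For 1 <= t <= 2 one has L <= 1 and the
    left side is negative.  For t > 2 the tangent bound ln L <= L/a - 1 + ln a
    reduces it to a ln(a/2) < 1 + 2 ln 2 + 2 ln t, which holds as a <= 9/2.  The
    remaining case n = 2 is numerical. *)
Lemma s_gt0 n : (2 <= n)%N -> 0 < s R n.
Proof.
move=> n2; rewrite sE//; have := ln_nat_ge n2; set t := ln n%:R => tl.
have /andP[l1 l2] := @ln2_bounds R; have t0 : 0 < t by lra.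
have /andP[a4 a9] := log_exponent_bounds; set a := log_exponent in a4 a9 *.
have L0 := iter_log_gt0 t0.
rewrite subr_gt0 gt_max; apply/andP; split; last by lra.
set l := ln (2 : R) in tl l1 l2 *.
have h32 : ln (3 / 2 : R) <= (3 / 2 - 2 / 3) / 2.
  by have := @ln_le_half_diff R (3 / 2); rewrite invf_div; apply; lra.
have [n3|n3] := leqP 3 n.
  have t1 : 1 <= t.
    have /andP[_ e3] := @expR1_bounds R.
    rewrite -(expRK 1) ler_ln ?posrE ?expR_gt0 ?ltr0n//; last by apply: leq_trans n2.
    by apply: le_trans e3 _; rewrite ler_nat.
  have [t2|t2] := leP t 2.
    have L1 : t - 2 * ln t <= 1.
      have := ln_ge_1BV t0.
      rewrite -(ler_pM2l t0) mulrBr divff ?gt_eqF//.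
      have : 0 <= (t - 1) * (2 - t) by rewrite mulr_ge0//; lra.
      by rewrite -[_ <= 1](ler_pM2l t0); lra.
    have lL : ln (t - 2 * ln t) <= 0 by rewrite ln_le0.
    nra.
  have a0 : 0 < a by lra.
  have lt2 : l <= ln t by rewrite ler_ln ?posrE//; lra.
  (* a / 2 <= 9/4 = (3/2)^2. *)
  have la : ln a - l <= 2 * ln (3 / 2).
    rewrite -ln_div ?posrE// mulr_natl -lnXn; last by lra.
    by rewrite ler_ln ?posrE ?divr_gt0 ?exprn_gt0//; lra.
  have lL : ln (t - 2 * ln t) <= (t - 2 * ln t) / a - 1 + ln a.
    have := @ln_le_B1 R ((t - 2 * ln t) / a).
    by rewrite divr_gt0// ln_div ?posrE// => /(_ isT); lra.
  have aL : a * ln (t - 2 * ln t) <= (t - 2 * ln t) - a + a * ln a.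
    move: lL; rewrite -(ler_pM2l a0) => /le_trans; apply.
    by rewrite le_eqVlt; apply/orP; left; apply/eqP; field; rewrite gt_eqF.
  have al : a * (ln a - l) <= 9 / 2 * (5 / 6) by nra.
  lra.
have nE : n = 2%N by apply/eqP; rewrite eqn_leq n2 -ltnS n3.
have tE : t = l by rewrite /t nE.
rewrite tE.
have l0 : 0 < l by lra.
(* - 2 ln l = ln 2 + ln (1 / (2 l^2)), and 2 l^2 is close to 1. *)
have Lu : l - 2 * ln l <= 2 * l + 5 / 100.
  have := @ln_le_B1 R ((2 * l ^+ 2)^-1).
  rewrite invr_gt0 mulr_gt0 ?exprn_gt0// lnV ?posrE ?mulr_gt0 ?exprn_gt0//.
  rewrite lnM ?posrE ?exprn_gt0// lnXn// -/l => /(_ isT).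
  have : (2 * l ^+ 2)^-1 <= 105 / 100.
    rewrite -div1r ler_pdivrMr ?mulr_gt0 ?exprn_gt0//.
    have : (691 / 1000) * (691 / 1000) <= l * l by apply: ler_pM; lra.
    lra.
  lra.
rewrite tE in L0.
(* The tangent at (6/5)^2 = 1.44, close to the value 1.426 of l - 2 ln l. *)
have lL : ln (l - 2 * ln l) <= 371 / 1000.
  have := @ln_le_B1 R ((l - 2 * ln l) / (6 / 5) ^+ 2).
  rewrite divr_gt0// ln_div ?posrE// lnXn// => /(_ isT).
  have := @ln_le_half_diff R (6 / 5); rewrite invf_div => /(_ ltac:(lra)); lra.
have : a * (1 - l + ln (l - 2 * ln l)) <= 9 / 2 * (68 / 100) by nra.
lra.
Qed.

(** For n >= 3 this is s(n) <= t - 2 ln t combined with ln s(n) <= ln t, where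
    t = ln n >= 1.  For n = 2 the number 2 ln t is negative, and the other term
    of the maximum gives s(2) <= 1. *)
Lemma s_growth n : (2 <= n)%N -> s R n + 2 * ln (s R n) <= ln (4 * n%:R).
Proof.
move=> n2; have s0 := s_gt0 n2; move: s0; rewrite sE//.
have := ln_nat_ge n2; set t := ln n%:R => tl.
have /andP[l1 l2] := @ln2_bounds R; have t0 : 0 < t by lra.
have /andP[a4 a9] := log_exponent_bounds; set a := log_exponent in a4 a9 *.
have n0 : 0 < n%:R :> R by rewrite ltr0n; apply: leq_trans n2.
rewrite lnM ?posrE// -/t (_ : 4 = 2 ^+ 2 :> R); last by lra.
rewrite lnXn//.
set M := Num.max _ _ => s0.
have M1 : a - 1 - (a + 2) * ln 2 + a * ln (t - 2 * ln t) <= M by rewrite le_max lexx.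
have M2 : 2 * ln t <= M by rewrite le_max lexx orbT.
have [n3|n3] := leqP 3 n.
  have t1 : 0 <= ln t.
    rewrite ln_ge0//; have /andP[_ e3] := @expR1_bounds R.
    rewrite -(expRK 1) ler_ln ?posrE ?expR_gt0//.
    by apply: le_trans e3 _; rewrite ler_nat.
  have : ln (t - M) <= ln t by rewrite ler_ln ?posrE//; lra.
  lra.
have nE : n = 2%N by apply/eqP; rewrite eqn_leq n2 -ltnS n3.
have tE : t = ln 2 by rewrite /t nE.
move: M1 s0; rewrite tE; move: l1 l2; set l := ln (2 : R) => l1 l2 M1 s0.
have l0 : 0 < l by lra.
have lnl := ln_le_B1 l0.
(* Here ln l <= l - 1 < 0. *)
have L1 : 13 / 10 <= l - 2 * ln l by lra.
have lL : 23 / 100 <= ln (l - 2 * ln l).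
  have L0 : 0 < l - 2 * ln l by lra.
  apply: le_trans (ln_ge_1BV L0).
  have : (l - 2 * ln l)^-1 <= 10 / 13.
    by rewrite -div1r ler_pdivrMr//; lra.
  lra.
have aL : 4 * (532 / 1000) <= a * (1 - l + ln (l - 2 * ln l)) by nra.
have s1 : l - M <= 1 by lra.
have := ln_le0 s1; lra.
Qed.
End ThresholdRate.

(** * Levels of a monotone set and the threshold width *)

Section Levels.
Context {R : realType} {n : nat}.
Implicit Types (p : R) (A : {set cube n}) (x y : cube n).

Lemma mu0 A : nontrivial A -> monotone_set A -> mu (0 : R) A = 0.
Proof.
move=> [_ AT] mA; rewrite /mu big1// => x xA.
have [i xi] : exists i, x i.
  apply/existsP; apply: contra_notT AT => /existsPn x0.
  apply/setP => y; rewrite finset.inE; apply: mA xA _ => i.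
  by rewrite (negbTE (x0 i)).
by rewrite mu_pt_prod (bigD1 i)//= xi mul0r.
Qed.

Lemma mu1 A : nontrivial A -> monotone_set A -> mu (1 : R) A = 1.
Proof.
move=> [A0 _] mA; rewrite -[RHS](sum_mu_pt (n := n) 1) (bigID (mem A))/=.
rewrite [X in _ + X]big1 ?addr0// => x xA.
have [i xi] : exists i, ~~ x i.
  apply/existsP; rewrite -negb_forall; apply: contraNN xA => /forallP x1.
  have /finset.set0Pn[y yA] : A != finset.set0 by apply/eqP.
  by apply: mA yA _ => i; rewrite x1 leq_b1.
by rewrite mu_pt_prod (bigD1 i)//= (negbTE xi) subrr mul0r.
Qed.

(** The measure of A is continuous in p and goes from 0 to 1. *)
Lemma p_levelP A (alpha : R) : nontrivial A -> monotone_set A -> 0 < alpha < 1 ->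
  0 < p_level A alpha < 1 /\ mu (p_level A alpha) A = alpha.
Proof.
move=> ntA mA a01; have [m0 m1] := (mu0 ntA mA, mu1 ntA mA).
have [p p01 pE] : exists2 p : R, p \in `[0, 1]%R & mu p A = alpha.
  apply: (@IVT R (fun q => mu q A) 0 1 alpha) => //.
    by apply: derivable_within_continuous => x _; exact: derivable_mu.
  by rewrite m0 m1 /Num.min /Num.max ltr01; lra.
have : [set p : R | 0 <= p <= 1 /\ mu p A = alpha] (p_level A alpha).
  by rewrite /p_level; apply: (@xgetPex _ 0 _); exists p; split=> //; rewrite in_itv/= in p01.
move=> [/andP[l0 l1] lE]; split=> //.
rewrite !lt_neqAle l0 l1 !andbT; apply/andP; split; apply/eqP => E.
  by move: lE; rewrite -E m0 => E'; lra.
by move: lE; rewrite E m1 => E'; lra.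
Qed.

(** If it failed, x = p (1-p) D would satisfy 2 x <= v s(n), whence
    n v / (4 x^2) >= 4 n / s(n)^2 since v <= 1/4, and
    [falik_samorodnitsky_symmetric] would contradict [s_growth]. *)
Lemma influence_sum_lower_bound p A (m := mu p A) : (2 <= n)%N ->
  0 < p < 1 -> nontrivial A -> monotone_set A -> symmetric_set A ->
  m * (1 - m) * s R n <= p * (1 - p) * c_LS p * \sum_i influence p A i.
Proof.
move=> n2 p01 ntA mA sA.
have [v0 vx] := falik_samorodnitsky_symmetric p01 ntA mA sA; rewrite -/m.
set v := m * (1 - m) in v0 vx *; set D := \sum_i _.
set x := p * (1 - p) * D in vx * => H.
have -> : p * (1 - p) * c_LS p * D = c_LS p * x by rewrite /x; ring.
have [c2 _] := c_LS_bounds p01; set c := c_LS p in c2 H *.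
have s0 : 0 < s R n := s_gt0 n2; have sg := s_growth n2 : s R n + _ <= _.
set S := s R n in s0 sg *.
rewrite leNgt; apply/negP => cx.
have v4 : v <= 1 / 4 by rewrite /v; have := sqr_ge0 (m - 1 / 2); lra.
have x0 : 0 < x := lt_le_trans v0 vx.
have n0 : 0 < n%:R :> R by rewrite ltr0n; apply: leq_trans n2.
have x2 : 2 * x <= v * S by apply: le_trans (ltW cx); rewrite ler_pM2r.
have x4 : 4 * x ^+ 2 <= (v * S) ^+ 2.
  rewrite (_ : 4 * x ^+ 2 = (2 * x) ^+ 2); last by ring.
  by rewrite lerXn2r ?nnegrE// mulr_ge0// ltW.
have : 4 * n%:R / S ^+ 2 <= n%:R * v / (4 * x ^+ 2).
  rewrite ler_pdivrMr ?exprn_gt0// mulrAC ler_pdivlMr; last by rewrite mulr_gt0// exprn_gt0.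
  apply: (@le_trans _ _ (4 * n%:R * (v * S) ^+ 2)); first by rewrite ler_pM2l// mulr_gt0.
  have -> : n%:R * v * S ^+ 2 = 4 * n%:R * (v * S ^+ 2 * (1 / 4)) by field.
  rewrite ler_pM2l ?mulr_gt0//.
  have -> : (v * S) ^+ 2 = v * S ^+ 2 * v by ring.
  by rewrite ler_pM2l// mulr_gt0// exprn_gt0.
have n4 : 0 < 4 * n%:R :> R by rewrite mulr_gt0.
have S2 : 0 < S ^+ 2 by rewrite exprn_gt0.
have y0 : 0 < 4 * x ^+ 2 by rewrite mulr_gt0// exprn_gt0.
move=> le4; have lnle : ln (4 * n%:R) - ln S *+ 2 <= ln (n%:R * v / (4 * x ^+ 2)).
  by rewrite -lnXn// -ln_div ?posrE// ler_ln ?posrE// divr_gt0// mulr_gt0.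
have : v * (ln (4 * n%:R) - ln S *+ 2) < v * S.
  by apply: le_lt_trans cx; apply: le_trans H; rewrite ler_pM2l.
rewrite ltr_pM2l//; lra.
Qed.

End Levels.

(** The function whose derivative is K D / (m (1 - m)) - s(n) is nondecreasing
    between the two levels, because D >= m (1 - m) s(n) / K there. *)
Theorem corollary4p3 (R : realType) (n : nat) (hn : (2 <= n)%N)
    (eps : R) (heps : 0 < eps < 1 / 2)
    (A : {set cube n}) (hA : nontrivial A) (hmon : monotone_set A)
    (hsym : symmetric_set A) :
  threshold_width A eps <=
    sup [set p * (1 - p) * c_LS p | p in
           [set p : R | p_level A eps <= p <= p_level A (1 - eps)]]
    * (2 * ln ((1 - eps) / eps) / s R n)
  /\
  threshold_width A eps <= ln ((1 - eps) / eps) / s R n.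
Proof.
have [p01 mp] : 0 < p_level A eps < 1 /\ mu (p_level A eps) A = eps.
  by apply: p_levelP => //; lra.
have [q01 mq] : 0 < p_level A (1 - eps) < 1 /\ mu (p_level A (1 - eps)) A = 1 - eps.
  by apply: p_levelP => //; lra.
rewrite /threshold_width; move: p01 mp q01 mq.
set p := p_level A eps; set q := p_level A (1 - eps) => p01 mp q01 mq.
set E := [set _ | _ in _]; set K := sup E.
have S0 : 0 < s R n := s_gt0 hn.
have D0 (z : R) : 0 < z < 1 -> 0 < \sum_i influence z A i.
  move=> z01; have [v0 vx _] := falik_samorodnitsky_symmetric z01 hA hmon hsym.
  have := lt_le_trans v0 vx; rewrite pmulr_rgt0//.
  by rewrite mulr_gt0//; lra.
have pq : p <= q.
  rewrite leNgt; apply/negP => qp.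
  suff : mu q A <= mu p A by rewrite mp mq; lra.
  apply: (derive_ge0_le (f := fun z => mu z A) (ltW qp)) => z zpq.
    by apply: russo; lra.
  by apply: ltW; apply: D0; lra.
have Eub z : E z -> z <= 1 / 2.
  move=> [y /= ypq <-]; have [|_] := @c_LS_bounds R y; first lra.
  by [].
have EK y : p <= y <= q -> y * (1 - y) * c_LS y <= K.
  move=> ypq; apply: ub_le_sup; first by exists (1 / 2) => z /Eub.
  by exists y.
have K2 : K <= 1 / 2.
  by apply: ge_sup => //; exists (p * (1 - p) * c_LS p); exists p => //=; rewrite lexx.
have K0 : 0 < K.
  apply: lt_le_trans (EK p _); last by rewrite lexx.
  have [c2 _] := c_LS_bounds p01.
  by rewrite !mulr_gt0//; lra.
have L0 : 0 <= ln ((1 - eps) / eps).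
  by rewrite ln_ge0// ler_pdivlMr; lra.
have main : (q - p) * s R n <= K * (2 * ln ((1 - eps) / eps)).
  have := derive_ge0_le (f := fun z => K * (ln (mu z A) - ln (1 - mu z A)) - z * s R n)
    (df := fun z => K * ((\sum_i influence z A i) / (mu z A * (1 - mu z A))) - s R n) pq.
  rewrite mp mq ln_div ?posrE; try lra.
  rewrite (_ : 1 - (1 - eps) = eps); last by ring.
  move=> H; suff : K * (ln eps - ln (1 - eps)) - p * s R n <=
      K * (ln (1 - eps) - ln eps) - q * s R n by lra.
  apply: H => z zpq; have z01 : 0 < z < 1 by lra.
    have m01 := mu_gt0_lt1 z01 hA.
    have dm := russo A z01.
    have d1 : is_derive z 1 (fun y => ln (mu y A)) ((mu z A)^-1 * \sum_i influence z A i).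
      have dl : is_derive (mu z A) 1 (@ln R) (mu z A)^-1 by apply: is_derive1_ln; lra.
      exact: (@is_derive1_comp _ (@ln R) (fun y => mu y A)).
    have d2 : is_derive z 1 (fun y => ln (1 - mu y A))
        ((1 - mu z A)^-1 * - \sum_i influence z A i).
      have dl : is_derive (1 - mu z A) 1 (@ln R) (1 - mu z A)^-1 by apply: is_derive1_ln; lra.
      have d1m : is_derive z 1 (fun y => 1 - mu y A) (- \sum_i influence z A i).
        by apply: is_derive_eq; rewrite add0r mul1r.
      exact: (@is_derive1_comp _ (@ln R) (fun y => 1 - mu y A)).
    apply: is_derive_eq; rewrite /GRing.scale/=.
    by field; apply/andP; split; rewrite gt_eqF; lra.
  have m01 := mu_gt0_lt1 z01 hA.
  have v0 : 0 < mu z A * (1 - mu z A) by rewrite mulr_gt0//; lra.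
  rewrite subr_ge0 mulrA ler_pdivlMr// mulrC.
  apply: (le_trans (influence_sum_lower_bound hn z01 hA hmon hsym)).
  by rewrite ler_pM2r ?D0// EK.
have first : q - p <= K * (2 * ln ((1 - eps) / eps) / s R n).
  by rewrite mulrA ler_pdivlMr.
split=> //; apply: (le_trans first).
rewrite mulrA ler_pM2r ?invr_gt0//.
by have := ler_wpM2r L0 K2; lra.
Qed.
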